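(* Let $\Gamma$ be an amenable group with finite symmetric generating set $S$ and associated word distance $d_W$, and suppose that there are $v\in Z(\Gamma)$ and $\rho>1$ and constants $0<c_1\le c_2<\infty$ such that $c_1k^{1/\rho}\le d_W(v^k,e_\Gamma)\le c_2k^{1/\rho}$ for all integers $k\ge1$. Then there is a constant $C<\infty$ depending only on these data ($\Gamma$, $S$, $v$, $\rho$) such that the following holds. Let $q\ge 2$, let $(X,\|\cdot\|_X)$ be a $q$-uniformly convex Banach space, and let $f:\Gamma\to X$ be a $1$-Lipschitz function. Then for every $\varepsilon>0$ there is an integer $N_\varepsilon$ such that for every $t\ge N_\varepsilon$ there exists an integer $n$ with $t\le n\le t^{1+\varepsilon}$ and $$\frac{\omega_f(n)}{n}\ \le\ C\,K_q(X)\Big(\frac{\log\log n}{\varepsilon\log n}\Big)^{1/q}.$$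
   Context: $d_W(p,q)=\inf\{n\ge 0: p=qa_1\cdots a_n,\ a_1,\dots,a_n\in S\}$, and $Z(\Gamma)$ is the center of $\Gamma$. The compression rate of a Lipschitz function $f:(\mathcal M,d)\to(X,\|\cdot\|_X)$ from a metric space into a Banach space is the largest nondecreasing function $\omega_f:(0,\infty)\to[0,\infty)$ such that $\|f(x)-f(y)\|_X\ge\omega_f(d(x,y))$ for all $x,y\in\mathcal M$. For a Banach space $(X,\|\cdot\|_X)$ and $q\ge 2$, $$K_q(X)=\inf\Big\{K>0:\ \forall x,y\in X,\ \|x\|_X^q+\tfrac{1}{K^q}\|y\|_X^q\le \tfrac{\|x+y\|_X^q+\|x-y\|_X^q}{2}\Big\},$$ and $X$ is called $q$-uniformly convex if $K_q(X)<\infty$. *)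

(* Defs.v *)
From mathcomp Require Import all_boot all_order all_algebra.
From mathcomp Require Import all_classical all_reals all_analysis.

Set Implicit Arguments.
Unset Strict Implicit.
Unset Printing Implicit Defensive.

Import Order.TTheory GRing.Theory Num.Theory.
Import numFieldNormedType.Exports.

Local Open Scope classical_set_scope.
Local Open Scope ring_scope.

Definition symmetric_set (G : groupType) (S : set G) : Prop :=
  forall a, S a -> S (a^-1)%g.

(* The only subgroup containing S is the whole group. *)
Definition generating_set (G : groupType) (S : set G) : Prop :=
  forall H : set G, H 1%g -> (forall x y, H x -> H y -> H (x * y^-1)%g) ->
    S `<=` H -> H = setT.

(* This is an infimum of a set of reals: it has its intended meaning only when
   that set is nonempty, which holds for all p, q as soon as S is symmetric
   and generating.  The metric is invariant under left translations. *)
Definition word_dist (R : realType) (G : groupType) (S : set G) (p q : G) : R :=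
  inf [set n%:R | n in [set n : nat | exists w : seq G,
    [/\ size w = n, forall a, a \in w -> S a
      & p = (q * \prod_(a <- w) a)%g]]].

(* Existence of a left-invariant mean on the bounded real functions on G; the
   values of m at unbounded functions are irrelevant. *)
Definition amenable (R : realType) (G : groupType) : Prop :=
  exists m : (G -> R) -> R,
    [/\ forall (a : R) (u v : G -> R), bounded_fun u -> bounded_fun v ->
          m (fun x => a * u x + v x) = a * m u + m v,
        forall u : G -> R, bounded_fun u -> (forall x, 0 <= u x) -> 0 <= m u,
        m (fun=> 1) = 1
      & forall (g : G) (u : G -> R), bounded_fun u ->
          m (fun x => u (g * x)%g) = m u].

Definition lipschitz1 (R : realType) (M : Type) (d : M -> M -> R)
    (X : normedModType R) (f : M -> X) : Prop :=
  forall x y, `|f x - f y| <= d x y.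

(* Functions on (0, oo) are encoded as functions on R whose values outside
   (0, oo) are irrelevant. *)
Definition compression_bound (R : realType) (M : Type) (d : M -> M -> R)
    (X : normedModType R) (f : M -> X) (w : R -> R) : Prop :=
  [/\ forall t, 0 < t -> 0 <= w t,
      forall s t, 0 < s -> s <= t -> w s <= w t
    & forall x y, 0 < d x y -> w (d x y) <= `|f x - f y|].

Definition is_compression_rate (R : realType) (M : Type) (d : M -> M -> R)
    (X : normedModType R) (f : M -> X) (w : R -> R) : Prop :=
  compression_bound d f w /\
  forall w', compression_bound d f w' -> forall t, 0 < t -> w' t <= w t.

(* Extended-real valued: K_q(X) = +oo when no K is admissible. *)
Definition convexity_const (R : realType) (q : R) (X : normedModType R)
    : \bar R :=
  ereal_inf [set K%:E | K in [set K : R | 0 < K /\ forall x y : X,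
    `|x| `^ q + (K `^ q)^-1 * `|y| `^ q
      <= (`|x + y| `^ q + `|x - y| `^ q) / 2]].

Definition uniformly_convex (R : realType) (q : R) (X : normedModType R)
    : Prop :=
  (convexity_const q X < +oo)%E.

(* Main.v *)
Require Import Defs.
From HB Require Import structures.
From mathcomp Require Import all_boot all_order all_algebra.
From mathcomp Require Import all_classical all_reals all_analysis.
From mathcomp Require Import ring lra.

Set Implicit Arguments.
Unset Strict Implicit.
Unset Printing Implicit Defensive.

Import Order.TTheory GRing.Theory Num.Theory.
Import numFieldNormedType.Exports.

Local Open Scope classical_set_scope.
Local Open Scope ring_scope.

(** The statement reduces to one about 1-cocycles, which is a quantitative mean
ergodic theorem in disguise.

Reduction to cocycles.  A left-invariant mean m turns the bounded functions
phi : G -> X into a seminormed space: |phi| is the q-th root of the mean of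
x |-> `|phi (x^-1)| `^ q.  This seminorm satisfies the same q-convexity
inequality as X ([mean_norm_seminorm], [mean_norm_convex]), and the right
translations pi act on the space by linear isometries.  The increments
F g = (x |-> f (x g) - f x) form a cocycle, F (g h) = F g + pi g (F h), which has
|F s| <= 1 for s in S and |F g| >= omega (d g), where d g is the word length of
g.  Hence it suffices to find, between t and t^(1 + eps), a length d (v^k) with
|F (v^k)| small compared with d (v^k).

Almost invariant averages.  Let T = pi v and let A_n be the average of
1, T, ..., T^(n-1).  Then A_(Mn) x is the average of the M vectors
T^(jn) (A_n x), all of the same norm, so q-convexity bounds the distance from one
of them to A_(Mn) x in terms of the drop |A_n x|^q - |A_(Mn) x|^q ([cesaro_gap]).
As T^l hardly moves A_(Mn) x when l is much smaller than Mn, a small drop makes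
A_n x almost invariant under T^l for all such l ([cesaro_displacement_gap]).
Since |A_n x|^q decreases when n is replaced by a multiple, it is within eta of
its infimum at all multiples of some n0, so one of J successive drops at such
scales is at most eta / J ([exists_stable_scale]).

Use of the centre.  As v is central, (1 - T^l) (F s) = (1 - pi s) (F (v^l)).  At a
scale n where the vectors A_n (F s) are almost invariant under T^l, the vector
A_n (F (v^l)) is therefore almost fixed by every s in S, hence moved by T^k by at
most a small multiple of d (v^k).  The same commutation rule says that T^l moves
A_n (F (v^k)) equally little.  Consequently A_n (F (v^k)) is close to the average
of its images under 1, T^k, ..., T^((M'-1)k), which is A_n (F (v^(M'k))) / M' and
has norm at most d (v^(M'k)) / M'; that is small compared with d (v^k) because
1 / rho < 1.  Finally F (v^k) differs from A_n (F (v^k)) by at most twice the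
largest d (v^i) with i < n, which is negligible when k is much larger than n
([cocycle_good_scale]).

Counting scales.  With h about log t, k = h^a n, M' = h^a and M = h^(3a) for a
fixed large a, all error terms are O (1 / h) ([cocycle_small_somewhere]), and the
number J of scales that fit below t^eps is of order eps log t / log log t, so
that (eta / J)^(1/q) has the order of the asserted rate ([exists_parameters]).
The threshold for t may depend on f, so eta can be taken as small as desired;
this absorbs all constants, and the bound holds with C = 1 as soon as
K_q(X) >= 1, which is the case unless X = 0. *)

(** * Real powers *)

Lemma powR_rootK (R : realType) (q x : R) : 0 < q -> 0 <= x ->
  (x `^ q) `^ (1 / q) = x.
Proof. by move=> q0 x0; rewrite -powRrM mul1r divff ?gt_eqF// powRr1. Qed.

Lemma powR_rootVK (R : realType) (q x : R) : 0 < q -> 0 <= x ->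
  (x `^ (1 / q)) `^ q = x.
Proof. by move=> q0 x0; rewrite -powRrM mul1r mulVf ?gt_eqF// powRr1. Qed.

Lemma powR_div (R : realType) (q x a : R) : 0 <= x -> 0 < a ->
  (x / a) `^ q = x `^ q / a `^ q.
Proof.
move=> x0 a0; apply: (mulIf (lt0r_neq0 (powR_gt0 q a0))).
rewrite -powRM ?divr_ge0 ?(ltW a0)// !divfK ?gt_eqF ?powR_gt0//.
Qed.

Lemma powR_convex_comb (R : realType) (q t x y : R) : 1 <= q ->
  0 <= t -> t <= 1 -> 0 <= x -> 0 <= y ->
  (t * x + (1 - t) * y) `^ q <= t * x `^ q + (1 - t) * y `^ q.
Proof.
move=> q1 t0 t1 x0 y0.
have := @convex_powR R q q1 (Itv01 t0 t1) x y.
by rewrite !inE/= !in_itv/= !andbT; apply.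
Qed.

(** Convexity of the power function at the barycentre of x / a and y / b with
weights a / (a + b) and b / (a + b); taking means of this form yields Minkowski's
inequality. *)
Lemma powR_add_le (R : realType) (q a b x y : R) : 1 <= q ->
  0 < a -> 0 < b -> 0 <= x -> 0 <= y ->
  (x + y) `^ q <= (a + b) `^ q *
    (a / (a + b) * (x `^ q / a `^ q) + b / (a + b) * (y `^ q / b `^ q)).
Proof.
move=> q1 a0 b0 x0 y0; have ab0 : 0 < a + b by lra.
have Et : 1 - a / (a + b) = b / (a + b) by field; lra.
have := @powR_convex_comb R q (a / (a + b)) (x / a) (y / b) q1.
rewrite Et divr_ge0 ?(ltW a0) ?(ltW ab0)// ler_pdivrMr// mul1r lerDl (ltW b0).
rewrite !divr_ge0 ?(ltW a0) ?(ltW b0)// => /(_ isT isT isT isT) h.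
have -> : x + y = (a + b) * (a / (a + b) * (x / a) + b / (a + b) * (y / b)).
  by field; lra.
have c0 : 0 <= a / (a + b) * (x / a) + b / (a + b) * (y / b).
  by rewrite addr_ge0// !mulr_ge0// ?invr_ge0; lra.
rewrite powRM ?(ltW ab0)// ler_pM2l ?powR_gt0//.
by rewrite -!powR_div ?(ltW a0) ?(ltW b0).
Qed.

(** * Seminorms *)

Definition is_seminorm (R : realType) (V : lmodType R) (p : V -> R) : Prop :=
  (forall x y, p (x + y) <= p x + p y) /\
  (forall (a : R) x, p (a *: x) = `|a| * p x).

Definition q_convex (R : realType) (V : lmodType R) (q K : R) (p : V -> R)
    : Prop :=
  forall x y, p x `^ q + (K `^ q)^-1 * p y `^ q
    <= (p (x + y) `^ q + p (x - y) `^ q) / 2.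

Lemma scalerD_half (R : realType) (V : lmodType R) (x : V) :
  (2^-1 : R) *: (x + x) = x.
Proof.
by rewrite -mulr2n -[x *+ 2]scaler_nat scalerA mulVf ?pnatr_eq0// scale1r.
Qed.

Section Seminorm.
Variables (R : realType) (V : lmodType R) (p : V -> R).
Hypothesis p_seminorm : is_seminorm p.

Lemma seminormD x y : p (x + y) <= p x + p y.
Proof. exact: p_seminorm.1. Qed.

Lemma seminormZ a x : p (a *: x) = `|a| * p x.
Proof. exact: p_seminorm.2. Qed.

Lemma seminorm0 : p 0 = 0.
Proof. by rewrite -(scale0r 0) seminormZ normr0 mul0r. Qed.

Lemma seminormN x : p (- x) = p x.
Proof. by rewrite -scaleN1r seminormZ normrN1 mul1r. Qed.

Lemma seminorm_ge0 x : 0 <= p x.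
Proof.
have := seminormD x (- x); rewrite subrr seminorm0 seminormN => h; lra.
Qed.

Lemma seminormB x y : p (x - y) <= p x + p y.
Proof. by rewrite -(seminormN y) seminormD. Qed.

Lemma seminorm_distC x y : p (x - y) = p (y - x).
Proof. by rewrite -seminormN opprB. Qed.

Lemma seminorm_dist_trans y x z : p (x - z) <= p (x - y) + p (y - z).
Proof. by rewrite (le_trans _ (seminormD _ _))// addrA subrK. Qed.

Lemma seminorm_sum n (F : nat -> V) c : (forall i, (i < n)%N -> p (F i) <= c) ->
  p (\sum_(i < n) F i) <= n%:R * c.
Proof.
elim: n => [|n IH] h; first by rewrite big_ord0 seminorm0 mul0r.
rewrite big_ord_recr/= (le_trans (seminormD _ _))//.
rewrite -addn1 natrD mulrDl mul1r lerD// ?h//.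
by apply: IH => i ilt; rewrite h// ltnW.
Qed.

Lemma seminorm_mean n (F : nat -> V) c : 0 <= c ->
  (forall i, (i < n)%N -> p (F i) <= c) ->
  p (n%:R^-1 *: \sum_(i < n) F i) <= c.
Proof.
move=> c0 h; rewrite seminormZ ger0_norm ?invr_ge0//.
case: n h => [|n] h; first by rewrite invr0 mul0r.
by rewrite mulrC ler_pdivrMr// mulrC seminorm_sum.
Qed.

(** An index with the largest norm works.  Used in this form, the triangle
inequality replaces Jensen's inequality for q-th powers in [cesaro_gap]. *)
Lemma seminorm_mean_exists n (F : nat -> V) : (0 < n)%N ->
  exists i, p (n%:R^-1 *: \sum_(i < n) F i) <= p (F i).
Proof.
move=> n0.
case: (arg_maxP (fun i : 'I_n => p (F i)) (isT : xpredT (Ordinal n0))).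
move=> i _ imax; exists i; apply: seminorm_mean => [|j jn].
  exact: seminorm_ge0.
exact: (imax (Ordinal jn) isT).
Qed.

End Seminorm.

(** * Averages of an isometric action along a cyclic subgroup *)

Lemma sum_ord_mul (V : zmodType) (M n : nat) (F : nat -> V) :
  \sum_(i < M * n) F i = \sum_(j < M) \sum_(i < n) F (j * n + i)%N.
Proof.
elim: M => [|M IH]; first by rewrite mul0n !big_ord0.
by rewrite mulSn addnC big_split_ord big_ord_recr/= -IH.
Qed.

Section IsometricAction.
Variables (R : realType) (G : groupType) (V : lmodType R) (p : V -> R).
Variable pi : G -> {linear V -> V}.
Hypothesis p_seminorm : is_seminorm p.
Hypothesis pi1 : forall x, pi 1%g x = x.
Hypothesis piM : forall g h x, pi (g * h)%g x = pi g (pi h x).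
Hypothesis pi_isom : forall g x, p (pi g x) = p x.

Lemma displacement_prod (w : seq G) (y : V) (e : R) :
  (forall a, a \in w -> p (y - pi a y) <= e) ->
  p (y - pi (\prod_(a <- w) a)%g y) <= (size w)%:R * e.
Proof.
elim: w => [|b w IH] h; first by rewrite big_nil pi1 subrr seminorm0// mul0r.
rewrite big_cons piM (le_trans (seminorm_dist_trans p_seminorm (pi b y) _ _))//.
rewrite -raddfB pi_isom /= -addn1 natrD mulrDl mul1r addrC lerD//.
  by apply: IH => a aw; rewrite h// inE aw orbT.
by rewrite h// inE eqxx.
Qed.

Variable v : G.

Definition cesaro (n : nat) (x : V) : V :=
  n%:R^-1 *: \sum_(i < n) pi (v ^+ i)%g x.

Lemma pi_vD i j x : pi (v ^+ (i + j))%g x = pi (v ^+ i)%g (pi (v ^+ j)%g x).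
Proof. by rewrite expgnDr piM. Qed.

Lemma cesaroD n x y : cesaro n (x + y) = cesaro n x + cesaro n y.
Proof.
by rewrite /cesaro -scalerDr -big_split/=; under eq_bigr do rewrite raddfD.
Qed.

Lemma cesaroN n x : cesaro n (- x) = - cesaro n x.
Proof.
by rewrite /cesaro -scalerN -sumrN; under eq_bigr do rewrite raddfN.
Qed.

Lemma cesaroB n x y : cesaro n (x - y) = cesaro n x - cesaro n y.
Proof. by rewrite cesaroD cesaroN. Qed.

Lemma cesaro_sum n m (F : nat -> V) :
  cesaro n (\sum_(i < m) F i) = \sum_(i < m) cesaro n (F i).
Proof.
elim: m => [|m IH]; last by rewrite !big_ord_recr/= cesaroD IH.
by rewrite !big_ord0 -[X in cesaro n X](subrr 0) cesaroB subrr.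
Qed.

Lemma cesaro_pi n g x : commute v g -> cesaro n (pi g x) = pi g (cesaro n x).
Proof.
move=> vg; have vig i : (v ^+ i * g = g * v ^+ i)%g.
  exact/commute_sym/commuteX/commute_sym.
rewrite /cesaro linearZ /=; congr (_ *: _); rewrite raddf_sum /=.
by under eq_bigr => i _ do rewrite -piM vig piM.
Qed.

Lemma cesaro_le n x : p (cesaro n x) <= p x.
Proof.
apply: (seminorm_mean p_seminorm (F := fun i => pi (v ^+ i)%g x)).
  exact: seminorm_ge0.
by move=> i _; rewrite pi_isom.
Qed.

Lemma cesaro_mul M n x :
  cesaro (M * n) x = M%:R^-1 *: \sum_(j < M) pi (v ^+ (j * n))%g (cesaro n x).
Proof.
rewrite /cesaro (sum_ord_mul _ _ (fun i => pi (v ^+ i)%g x)) natrM invfM.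
rewrite -scalerA; congr (_ *: _).
rewrite scaler_sumr; apply: eq_bigr => j _.
rewrite linearZ /=; congr (_ *: _); rewrite raddf_sum /=.
by under eq_bigr do rewrite pi_vD.
Qed.

Lemma cesaro_le_mul M n x : p (cesaro (M * n) x) <= p (cesaro n x).
Proof.
rewrite cesaro_mul.
apply: (seminorm_mean p_seminorm
  (F := fun j => pi (v ^+ (j * n))%g (cesaro n x))) => [|i _].
  exact: seminorm_ge0.
by rewrite pi_isom.
Qed.

Lemma cesaro_displacement n l x : (0 < n)%N ->
  p (cesaro n x - pi (v ^+ l)%g (cesaro n x)) <= l%:R * (2 * p x / n%:R).
Proof.
move=> n0.
have step : p (cesaro n x - pi v (cesaro n x)) <= 2 * p x / n%:R.
  rewrite /cesaro linearZ_LR -scalerBr seminormZ// raddf_sum.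
  rewrite ger0_norm ?invr_ge0// mulrC ler_pM2r ?invr_gt0 ?ltr0n//.
  rewrite -sumrB (eq_bigr (fun i : 'I_n =>
    - (pi (v ^+ i.+1)%g x - pi (v ^+ i)%g x))); last first.
    by move=> i _; rewrite /= -piM -expgS opprB.
  rewrite sumrN seminormN//.
  rewrite -(big_mkord xpredT (fun i => pi (v ^+ i.+1)%g x - pi (v ^+ i)%g x)).
  rewrite telescope_sumr// (le_trans (seminormB p_seminorm _ _))//.
  by rewrite !pi_isom mulr_natl mulr2n.
have -> : (v ^+ l)%g = (\prod_(a <- nseq l v) a)%g.
  by rewrite big_nseq; elim: l => [|l IH] //=; rewrite expgS IH.
rewrite -[X in X%:R * _](size_nseq l v) displacement_prod// => a.
by rewrite mem_nseq => /andP[_ /eqP ->].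
Qed.

Variables (q K : R).
Hypothesis q_gt0 : 0 < q.
Hypothesis K_gt0 : 0 < K.
Hypothesis p_convex : q_convex q K p.

(** Let z_j be the M translates of the n-average and z their mean, which is the
Mn-average.  The mean of the vectors (z_j + z) / 2 is again z, so one of them has
norm at least that of z.  For this j, the q-convexity inequality applied to
(z_j + z) / 2 and (z_j - z) / 2 bounds the latter by the drop of the norms. *)
Lemma cesaro_gap M n x : (0 < M)%N -> exists j : nat,
  p (pi (v ^+ (j * n))%g (cesaro n x) - cesaro (M * n) x)
    <= 2 * K *
       ((p (cesaro n x) `^ q - p (cesaro (M * n) x) `^ q) / 2) `^ (1 / q).
Proof.
move=> M0; set z := cesaro (M * n) x; set y := cesaro n x.
pose zj j := pi (v ^+ (j * n))%g y.
have [j zle] : exists j, p z <= p (2^-1 *: (zj j + z)).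
  have [j le_j] :=
    seminorm_mean_exists p_seminorm (fun j => 2^-1 *: (zj j + z)) M0.
  exists j; rewrite (le_trans _ le_j)//.
  rewrite -scaler_sumr big_split/= sumr_const card_ord scalerA mulrC -scalerA.
  rewrite scalerDr -cesaro_mul -/z -[z *+ M]scaler_nat scalerA.
  rewrite mulVf ?pnatr_eq0 -?lt0n//.
  by rewrite scale1r scalerD_half.
exists j; rewrite -/(zj j).
set w := 2^-1 *: (zj j + z) in zle; set u := 2^-1 *: (zj j - z).
have wDu : w + u = zj j.
  by rewrite /w /u -scalerDr [X in _ *: X]addrACA subrr addr0 scalerD_half.
have wBu : w - u = z.
  rewrite /w /u -scalerBr opprB [zj j + z]addrC [X in _ *: X]addrACA.
  by rewrite subrr addr0 scalerD_half.
(* w + u and w - u are the translate of y and z, whence the drop of the norms. *)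
have := p_convex w u; rewrite wDu wBu pi_isom => h.
have zw : p z `^ q <= p w `^ q.
  by rewrite ge0_ler_powR ?nnegrE ?(ltW q_gt0) ?seminorm_ge0.
have Kq : 0 < K `^ q by rewrite powR_gt0.
have {h zw} : p u `^ q <= K `^ q * ((p y `^ q - p z `^ q) / 2).
  by rewrite -ler_pdivrMl//; lra.
set D := _ / 2 => h.
have D0 : 0 <= D by rewrite -(pmulr_rge0 _ Kq) (le_trans _ h) ?powR_ge0.
clearbody D; have pu : p u <= K * D `^ (1 / q).
  rewrite -(powR_rootK q_gt0 (seminorm_ge0 p_seminorm u)).
  rewrite -[X in _ <= X * _](powR_rootK q_gt0 (ltW K_gt0)) -powRM ?powR_ge0//.
  by rewrite ge0_ler_powR ?nnegrE ?mulr_ge0 ?powR_ge0 ?invr_ge0 ?(ltW q_gt0).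
have -> : zj j - z = 2 *: u by rewrite scalerA divff ?pnatr_eq0// scale1r.
by rewrite seminormZ// ger0_norm// -mulrA ler_pM2l.
Qed.

(** The translate in [cesaro_gap] can be any of the M ones, but as T is an
isometry commuting with its powers, its displacement by T^l equals that of the
n-average itself. *)
Lemma cesaro_displacement_gap M n l x : (0 < M)%N -> (0 < n)%N ->
  p (cesaro n x - pi (v ^+ l)%g (cesaro n x)) <=
    4 * K * ((p (cesaro n x) `^ q - p (cesaro (M * n) x) `^ q) / 2) `^ (1 / q)
    + l%:R * (2 * p x / (M * n)%:R).
Proof.
move=> M0 n0; have [j] := cesaro_gap n x M0.
set D := _ `^ _; set z := cesaro (M * n) x; set y := cesaro n x => gap.
have zl : p (z - pi (v ^+ l)%g z) <= l%:R * (2 * p x / (M * n)%:R).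
  by rewrite cesaro_displacement// muln_gt0 M0.
rewrite -(pi_isom (v ^+ (j * n))%g) raddfB /= -pi_vD addnC pi_vD.
set u := pi _ y in gap *.
rewrite (le_trans (seminorm_dist_trans p_seminorm z _ _))//.
rewrite (_ : 4 * K * D + _ = 2 * K * D
  + (l%:R * (2 * p x / (M * n)%:R) + 2 * K * D)); last by ring.
rewrite lerD//.
rewrite (le_trans (seminorm_dist_trans p_seminorm (pi (v ^+ l)%g z) _ _))//.
by rewrite lerD// -raddfB pi_isom seminorm_distC.
Qed.

(** The sum Phi n of the q-th powers over xs decreases along divisibility, so
it stays within eta of its infimum on all multiples of a suitable n0.  The drops
along n0 r, M n0 r, ..., M^J n0 r then add up to at most eta, and the smallest
of these J drops controls every x in xs at once. *)
Lemma exists_stable_scale (xs : seq V) (eta : R) : 0 < eta ->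
  exists2 n0 : nat, (0 < n0)%N & forall r M J : nat,
    (0 < r)%N -> (0 < M)%N -> (0 < J)%N ->
    exists2 j : nat, (j < J)%N & forall x, x \in xs ->
      p (cesaro (M ^ j * (r * n0)) x) `^ q
      - p (cesaro (M * (M ^ j * (r * n0))) x) `^ q <= eta / J%:R.
Proof.
move=> eta0; pose Phi n := \sum_(x <- xs) p (cesaro n x) `^ q.
have term_le m n x : p (cesaro (m * n) x) `^ q <= p (cesaro n x) `^ q.
  by rewrite ge0_ler_powR ?nnegrE ?(ltW q_gt0) ?seminorm_ge0 ?cesaro_le_mul.
have Phi_le m n : Phi (m * n)%N <= Phi n.
  by apply: ler_sum => x _; exact: term_le.
pose E := [set Phi n | n in [set n : nat | (0 < n)%N]].
have E_lb : has_lbound E.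
  by exists 0 => _ [n _ <-]; apply: sumr_ge0 => x _; rewrite powR_ge0.
have E_inf : has_inf E by split=> //; exists (Phi 1%N), 1%N.
have [_ [n0 /= n0_gt0 <-] n0_inf] := inf_adherent eta0 E_inf.
exists n0 => // r M J r0 M0 J0.
pose N j := (M ^ j * (r * n0))%N.
have N_gt0 j : (0 < N j)%N by rewrite !muln_gt0 expn_gt0 M0 r0.
have NS j : N j.+1 = (M * N j)%N by rewrite /N expnS -mulnA.
have total : \sum_(j < J) (Phi (N j) - Phi (N j.+1)) <= eta.
  rewrite (eq_bigr (fun j : 'I_J => - (Phi (N j.+1) - Phi (N j)))); last first.
    by move=> j _; rewrite opprB.
  rewrite sumrN -(big_mkord xpredT (fun j => Phi (N j.+1) - Phi (N j))).
  rewrite telescope_sumr// opprB lerBlDr.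
  have : inf E <= Phi (N J).
    by apply: (ge_inf E_lb); exists (N J) => //=; exact: N_gt0.
  have : Phi (N 0%N) <= Phi n0 by rewrite /N expn0 mul1n; exact: Phi_le.
  by move: n0_inf; lra.
pose D (j : 'I_J) := Phi (N j) - Phi (N j.+1).
case: (arg_minP D (isT : xpredT (Ordinal J0))) => j _ jmin.
exists j => // x xxs; rewrite -/(N j) -NS.
have Dj : D j <= eta / J%:R.
  rewrite ler_pdivlMr ?ltr0n//; apply: le_trans total.
  rewrite -[X in _ * X%:R]card_ord mulr_natr -sumr_const.
  apply: ler_sum => i _.
  exact: (jmin i isT).
apply: le_trans Dj; rewrite /D /Phi -sumrB (big_rem x)//= lerDl.
by apply: sumr_ge0 => y _; rewrite subr_ge0 NS.
Qed.

End IsometricAction.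

(** * Cocycles *)

Section Cocycle.
Variables (R : realType) (G : groupType) (V : lmodType R) (p : V -> R).
Variable pi : G -> {linear V -> V}.
Hypothesis p_seminorm : is_seminorm p.
Hypothesis pi1 : forall x, pi 1%g x = x.
Hypothesis piM : forall g h x, pi (g * h)%g x = pi g (pi h x).
Hypothesis pi_isom : forall g x, p (pi g x) = p x.
Variable F : G -> V.
Hypothesis F_cocycle : forall g h, F (g * h)%g = F g + pi g (F h).

Lemma cocycle1 : F 1%g = 0.
Proof.
by apply/(addrI (F 1%g)); rewrite addr0 -[X in _ + X]pi1 -F_cocycle mulg1.
Qed.

(** Both sides come from the two expansions of F (g h) = F (h g).  It is this
exchange of roles that turns almost invariance under a power of v into almost
invariance under the generators, and back. *)
Lemma cocycle_displacementC g h : commute g h ->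
  F g - pi h (F g) = F h - pi g (F h).
Proof.
move=> gh; apply/eqP; rewrite subr_eq addrAC eq_sym subr_eq -!F_cocycle.
by rewrite gh.
Qed.

Lemma cocycle_prod (S : set G) (w : seq G) : (forall s, S s -> p (F s) <= 1) ->
  (forall a, a \in w -> S a) -> p (F (\prod_(a <- w) a)%g) <= (size w)%:R.
Proof.
move=> FS; elim: w => [|b w IH] wS.
  by rewrite big_nil cocycle1 seminorm0.
rewrite big_cons F_cocycle (le_trans (seminormD p_seminorm _ _))//= pi_isom.
rewrite -addn1 natrD addrC lerD//.
  by apply: IH => a aw; apply: wS; rewrite inE aw orbT.
by apply/FS/wS; rewrite inE eqxx.
Qed.

Lemma cocycleX g M :
  F (g ^+ M)%g = \sum_(i < M) pi (g ^+ i)%g (F g).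
Proof.
elim: M => [|M IH]; first by rewrite big_ord0 cocycle1.
by rewrite big_ord_recr/= expgSr F_cocycle IH.
Qed.

Variable v : G.
Hypothesis v_central : forall g, commute v g.

Lemma central_powers g i : commute (v ^+ i)%g g.
Proof. exact/commute_sym/commuteX/commute_sym. Qed.

Variables (S : set G) (d : nat -> nat).
Hypothesis F_gen : forall s, S s -> p (F s) <= 1.
Hypothesis v_word : forall k, exists w : seq G,
  [/\ size w = d k, forall a, a \in w -> S a & (v ^+ k = \prod_(a <- w) a)%g].

Local Notation A := (cesaro pi v).

Lemma cocycle_power_le k : p (F (v ^+ k)%g) <= (d k)%:R.
Proof. by have [w [<- wS ->]] := v_word k; exact: (cocycle_prod F_gen wS). Qed.

(** Write y l for the n-average of F (v^l).  Exchanging v^l with a generator s,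
the hypothesis says that s moves y l by at most delta + l sigma; hence v^k moves
it by at most d k times this, and exchanging v^k with v^l the same holds for the
motion of y k under v^l.  So y k is close to the average of its translates by
1, v^k, ..., v^((M-1)k), which is y (M k) / M.  The last term 2 b bounds the
distance from F (v^k) to its n-average, as F (v^k) - T^i (F (v^k)) equals
F (v^i) - T^k (F (v^i)). *)
Lemma cocycle_good_scale n (delta sigma b : R) M k : (0 < M)%N ->
  (forall s, S s -> forall l,
     p (A n (F s) - pi (v ^+ l)%g (A n (F s))) <= delta + l%:R * sigma) ->
  0 <= delta -> 0 <= sigma -> (0 < n)%N ->
  (forall i, (i < n)%N -> p (F (v ^+ i)%g) <= b) ->
  p (F (v ^+ k)%g) <= (d (M * k))%:R / M%:R
    + (d k)%:R * (delta + (M * k)%:R * sigma) + 2 * b.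
Proof.
move=> M0 gap delta0 sigma0 n0 Fb.
pose y l := A n (F (v ^+ l)%g).
have swap (g h : G) : commute g h ->
    A n (F g) - pi h (A n (F g)) = A n (F h) - pi g (A n (F h)).
  move=> gh; rewrite -!cesaro_pi -?cesaroB//.
  by rewrite cocycle_displacementC.
(* From powers of v to generators, then back to powers of v. *)
have gen_disp l s : S s -> p (y l - pi s (y l)) <= delta + l%:R * sigma.
  by move=> Ss; rewrite swap ?gap//; exact: central_powers.
have disp l :
    p (y k - pi (v ^+ l)%g (y k)) <= (d k)%:R * (delta + l%:R * sigma).
  rewrite /y swap; last exact: central_powers.
  have [w [<- wS ->]] := v_word k.
  apply: (displacement_prod p_seminorm pi1 piM pi_isom) => a aw.
  exact/gen_disp/wS.
have yk : y k = M%:R^-1 *: y (M * k)%N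
    + M%:R^-1 *: \sum_(i < M) (y k - pi (v ^+ (i * k))%g (y k)).
  rewrite sumrB sumr_const card_ord -scalerDr.
  have -> : y (M * k)%N = \sum_(i < M) pi (v ^+ (i * k))%g (y k).
    rewrite /y [(M * k)%N]mulnC expgnA (cocycleX _ M).
    have /= -> :=
      cesaro_sum pi v n M (fun i => pi ((v ^+ k) ^+ i)%g (F (v ^+ k)%g)).
    apply: eq_bigr => i _; rewrite (cesaro_pi piM); last exact: v_central.
    by rewrite -expgnA mulnC.
  rewrite subrKC -[y k *+ M]scaler_nat scalerA mulVf ?scale1r//.
  by rewrite pnatr_eq0 -lt0n.
have py : p (y k) <= (d (M * k))%:R / M%:R
    + (d k)%:R * (delta + (M * k)%:R * sigma).
  rewrite yk (le_trans (seminormD p_seminorm _ _))// lerD//.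
    rewrite seminormZ// ger0_norm ?invr_ge0// mulrC ler_pM2r ?invr_gt0 ?ltr0n//.
    rewrite (le_trans (cesaro_le p_seminorm pi_isom _ _ _))//.
    exact: cocycle_power_le.
  apply: (seminorm_mean p_seminorm
    (F := fun i => y k - pi (v ^+ (i * k))%g (y k))).
    by rewrite mulr_ge0// addr_ge0// mulr_ge0.
  move=> i iM; rewrite (le_trans (disp _))// ler_wpM2l// lerD2l ler_wpM2r//.
  by rewrite ler_nat leq_mul2r (ltnW iM) orbT.
have b0 : 0 <= b by rewrite (le_trans _ (Fb 0%N n0))// seminorm_ge0.
have Fy : p (F (v ^+ k)%g - y k) <= 2 * b.
  have -> : F (v ^+ k)%g - y k = n%:R^-1 *: \sum_(i < n)
      (F (v ^+ k)%g - pi (v ^+ i)%g (F (v ^+ k)%g)).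
    rewrite sumrB sumr_const card_ord scalerBr -[F _ *+ n]scaler_nat scalerA.
    rewrite mulVf ?scale1r//.
    by rewrite pnatr_eq0 -lt0n.
  apply: (seminorm_mean p_seminorm
    (F := fun i => F (v ^+ k)%g - pi (v ^+ i)%g (F (v ^+ k)%g))).
    by rewrite mulr_ge0.
  move=> i ilt; rewrite cocycle_displacementC; last exact: central_powers.
  rewrite (le_trans (seminormB p_seminorm _ _))// pi_isom mulr_natl mulr2n.
  by rewrite lerD// Fb.
rewrite -(subrK (y k) (F _)) addrC (le_trans (seminormD p_seminorm _ _))//.
by rewrite addrC [leRHS]addrC lerD.
Qed.


Variables (q K : R).
Hypothesis q_gt0 : 0 < q.
Hypothesis K_gt0 : 0 < K.
Hypothesis p_convex : q_convex q K p.
Hypothesis S_fin : finite_set S.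
Variables (rho c1 c2 : R) (a : nat).
Hypothesis c1_gt0 : 0 < c1.
Hypothesis c2_gt0 : 0 < c2.
Hypothesis rho_gt0 : 0 < rho.
Hypothesis d_ge : forall k, (0 < k)%N -> c1 * k%:R `^ (1 / rho) <= (d k)%:R.
Hypothesis d_le : forall k, (0 < k)%N -> (d k)%:R <= c2 * k%:R `^ (1 / rho).
Hypothesis a_rho : 1 <= a%:R / rho.
Hypothesis a_conj : 1 <= a%:R * (1 - 1 / rho).

(** The scale n is one where the averages of all F s with s in S drop by little
between n and Mn; these finitely many vectors are handled by a single scale. *)
Lemma cocycle_stable_scale (eta : R) : 0 < eta ->
  exists2 n0 : nat, (0 < n0)%N & forall r M J : nat,
    (0 < r)%N -> (0 < M)%N -> (0 < J)%N ->
    exists2 j : nat, (j < J)%N &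
      forall M' k, (0 < M')%N ->
      let n := (M ^ j * (r * n0))%N in
      p (F (v ^+ k)%g) <= (d (M' * k))%:R / M'%:R
        + (d k)%:R * (4 * K * (eta / J%:R / 2) `^ (1 / q)
                      + (M' * k)%:R * (2 / (M * n)%:R))
        + 2 * (c2 * n%:R `^ (1 / rho)).
Proof.
move=> eta0; have /finite_seqP[gens Sgens] := S_fin.
have [n0 n0_gt0 stable] :=
  exists_stable_scale p_seminorm piM pi_isom v q_gt0 [seq F s | s <- gens] eta0.
exists n0 => // r M J r0 M0 J0; have [j jJ gap] := stable r M J r0 M0 J0.
exists j => // M' k M'0 /=; set n := (M ^ j * (r * n0))%N.
have n_gt0 : (0 < n)%N by rewrite !muln_gt0 expn_gt0 M0 r0.
apply: (cocycle_good_scale (n := n)) => // [s Ss l||i i_lt].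
- have Fs : F s \in [seq F s | s <- gens].
    by apply: map_f; move: Ss; rewrite Sgens.
  apply: le_trans (cesaro_displacement_gap p_seminorm pi1 piM pi_isom v q_gt0
    K_gt0 p_convex l _ M0 n_gt0) _.
  rewrite lerD//.
    rewrite ler_wpM2l ?mulr_ge0 ?(ltW K_gt0)//.
    have D0 : 0 <= p (A n (F s)) `^ q - p (A (M * n) (F s)) `^ q.
      rewrite subr_ge0 ge0_ler_powR ?nnegrE ?(ltW q_gt0) ?seminorm_ge0//.
      exact: cesaro_le_mul.
    rewrite ge0_ler_powR ?nnegrE ?divr_ge0 ?(ltW q_gt0) ?(ltW eta0)//.
    by rewrite ler_pM2r ?invr_gt0//; exact: gap.
  rewrite ler_wpM2l// ler_wpM2r ?invr_ge0// ler_piMr//; exact: F_gen.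
- by rewrite !mulr_ge0 ?powR_ge0 ?(ltW K_gt0).
(* The bounds on d start at 1; the term i = 0 is F 1 = 0. *)
- case: i i_lt => [|i] i_lt.
    by rewrite expg0 cocycle1 seminorm0// mulr_ge0 ?powR_ge0 ?(ltW c2_gt0).
  apply: le_trans (cocycle_power_le _) _; apply: le_trans (d_le _) _ => //.
  rewrite ler_wpM2l ?(ltW c2_gt0)//.
  rewrite ge0_ler_powR ?nnegrE ?divr_ge0 ?(ltW rho_gt0)//.
  by rewrite ler_nat ltnW.
Qed.

Lemma powR_expn_le_inv (h : nat) (e : R) : (0 < h)%N -> 1 <= a%:R * e ->
  ((h ^ a)%N%:R `^ e)^-1 <= h%:R^-1.
Proof.
move=> h0 ae; have h1 : (1 : R) <= h%:R by rewrite ler1n.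
rewrite natrX -powR_mulrn// -powRrM lef_pV2 ?posrE ?powR_gt0 ?ltr0n//.
by rewrite -[leLHS]powRr1// ler_powR.
Qed.

(** The choice k = h^a n, M' = h^a and M = h^(3a) makes the ratios
M'^(1/rho) / M', (n / k)^(1/rho) and M' k / (M n) equal to h^(-a(1-1/rho)),
h^(-a/rho) and h^(-a), each of which is at most 1 / h by the choice of a. *)
Lemma cocycle_small_somewhere (eta : R) : 0 < eta ->
  exists2 n0 : nat, (0 < n0)%N & forall h r J : nat,
    (0 < h)%N -> (0 < r)%N -> (0 < J)%N ->
    exists2 j : nat, (j < J)%N &
      let k := (h ^ a * ((h ^ (3 * a)) ^ j * (r * n0)))%N in
      p (F (v ^+ k)%g) <= (d k)%:R *
        ((3 * (c2 / c1) + 2) / h%:R + 4 * K * (eta / J%:R / 2) `^ (1 / q)).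
Proof.
move=> eta0; have [n0 n0_gt0 stable] := cocycle_stable_scale eta0.
exists n0 => // h r J h0 r0 J0.
have M0 : (0 < h ^ (3 * a))%N by rewrite expn_gt0 h0.
have [j jJ small] := stable r _ J r0 M0 J0; exists j => // k.
have R0 : (0 < h ^ a)%N by rewrite expn_gt0 h0.
have := small (h ^ a)%N k R0 => /=; set n := ((h ^ (3 * a)) ^ j * (r * n0))%N.
set D := 4 * K * _ => Fk; apply: le_trans Fk _.
have n_gt0 : (0 < n)%N by rewrite !muln_gt0 expn_gt0 M0 r0.
have kE : k = (h ^ a * n)%N by [].
clearbody k n.
have k_gt0 : (0 < k)%N by rewrite kE muln_gt0 R0.
have dk := d_ge k_gt0.
have Hr : (0 : R) < h%:R by rewrite ltr0n.
have Rr : (0 : R) < (h ^ a)%:R by rewrite ltr0n.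
have nr : (0 : R) < n%:R by rewrite ltr0n.
have kle : k%:R `^ (1 / rho) <= (d k)%:R / c1 by rewrite ler_pdivlMr// mulrC.
(* The three error terms of the good scale, relative to d k. *)
have long : (d (h ^ a * k))%:R / (h ^ a)%:R <= (d k)%:R * (c2 / c1 / h%:R).
  have Mk0 : (0 < h ^ a * k)%N by rewrite muln_gt0 R0.
  rewrite ler_pdivrMr// (le_trans (d_le Mk0))// natrM powRM//.
  have E : (h ^ a)%:R `^ (1 / rho) <= h%:R^-1 * (h ^ a)%:R :> R.
    have y_split : (h ^ a)%:R =
        (h ^ a)%:R `^ (1 - 1 / rho) * (h ^ a)%:R `^ (1 / rho) :> R.
      by rewrite -powRD ?subrK ?powRr1// gt_eqF ?implybT.
    rewrite [in leRHS]y_split mulrA ler_peMl ?powR_ge0//.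
    have := powR_expn_le_inv h0 a_conj.
    rewrite lef_pV2 ?posrE ?powR_gt0// => hy.
    by rewrite -(ler_pM2l Hr) mulr1 mulVKf// gt_eqF.
  rewrite [leRHS](_ : _ =
    c2 * (h%:R^-1 * (h ^ a)%:R * ((d k)%:R / c1))); last by ring.
  by rewrite ler_wpM2l ?(ltW c2_gt0)// ler_pM// ?powR_ge0.
have short : n%:R `^ (1 / rho) <= (d k)%:R * (c1^-1 / h%:R).
  have E : n%:R `^ (1 / rho) = k%:R `^ (1 / rho) * ((h ^ a)%:R `^ (1 / rho))^-1.
    by rewrite kE natrM powRM// mulrAC divff ?mul1r// gt_eqF// powR_gt0.
  rewrite E mulrA ler_pM ?powR_ge0 ?invr_ge0 ?powR_ge0//.
  by apply: powR_expn_le_inv => //; rewrite mul1r.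
have middle : (h ^ a * k)%:R * (2 / (h ^ (3 * a) * n)%:R) <= 2 / h%:R :> R.
  have -> : (h ^ a * k)%:R * (2 / (h ^ (3 * a) * n)%:R) =
      2 * ((h ^ a)%:R `^ 1)^-1 :> R.
    rewrite kE (_ : h ^ (3 * a) = h ^ a * h ^ a * h ^ a)%N; last first.
      by rewrite !mulSn mul0n addn0 addnA !expnD.
    have cancel_yz (y z : R) : 0 < y -> 0 < z ->
        y * (y * z) * (2 / (y * y * y * z)) = 2 * y^-1.
      by move=> y0 z0; field; rewrite !gt_eqF.
    by rewrite !natrM powRr1// cancel_yz.
  rewrite ler_wpM2l// powR_expn_le_inv// mulr1 (le_trans a_conj)//.
  by rewrite ler_piMr// lerBlDr lerDl divr_ge0 ?(ltW rho_gt0).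
set D' := (h ^ a * k)%:R * _ in middle *.
have e1 := ler_wpM2l (ler0n R (d k)) middle.
have e2 := ler_wpM2l (ltW c2_gt0) short.
rewrite [leRHS](_ : _ = (d k)%:R * (c2 / c1 / h%:R) + ((d k)%:R * D
  + (d k)%:R * (2 / h%:R)) + 2 * (c2 * ((d k)%:R * (c1^-1 / h%:R)))); last first.
  by ring.
by rewrite mulrDr !lerD// ler_pM2l.
Qed.

End Cocycle.

(** * Choice of the scales *)

(** Here L = log t and u = log log t.  The claimed rate at D is at least
(u / (eps (1 + eps) L))^(1/q).  The first error is bounded by half of this since
h >= L and u exceeds a constant, the second one since J is at least of order
eps L / u and eta has been chosen small in terms of K, a and eps. *)
Lemma rate_bound (R : realType) (q K eps eta C0 u L D : R) (a h J : nat) :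
  1 <= q -> 0 < K -> 0 < eps -> 0 < eta -> 0 <= C0 -> 1 <= L -> 0 < u ->
  (0 < J)%N -> L <= ln D -> ln D <= (1 + eps) * L -> u <= ln (ln D) ->
  L <= h%:R -> eps * L <= 24 * a%:R * u * J%:R ->
  (2 * C0) `^ q * (eps * (1 + eps)) <= u ->
  (8 * K) `^ q * eta * (12 * a%:R * (1 + eps)) <= 1 ->
  C0 / h%:R + 4 * K * (eta / J%:R / 2) `^ (1 / q)
    <= (ln (ln D) / (eps * ln D)) `^ (1 / q).
Proof.
move=> q1 K0 eps0 eta0 C00 L1 u0 J0 LD DL uD Lh EJ Cu etaK.
have q0 : 0 < q by lra.
have L0 : 0 < L by lra.
have J0' : (0 : R) < J%:R by rewrite ltr0n.
have h1 : (1 : R) <= h%:R by lra.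
have h0 : (0 : R) < h%:R by lra.
have lnD0 : 0 < ln D by lra.
have eL0 : 0 < eps * (1 + eps) * L by rewrite !mulr_gt0//; lra.
pose X := u / (eps * (1 + eps) * L).
have e10 : 0 < 1 + eps by lra.
have X0 : 0 <= X by rewrite divr_ge0 ?(ltW u0) ?(ltW eL0).
have root_mono y z : 0 <= y -> y <= z -> y `^ (1 / q) <= z `^ (1 / q).
  move=> y0 yz.
  by rewrite ge0_ler_powR ?nnegrE ?divr_ge0 ?(ltW q0) ?(le_trans y0 yz).
have XD : X <= ln (ln D) / (eps * ln D).
  rewrite ler_pM ?invr_ge0 ?(ltW u0) ?(ltW eL0)// lef_pV2 ?posrE ?mulr_gt0//.
  by rewrite -mulrA ler_pM2l.
apply: le_trans (root_mono _ _ X0 XD).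
have first : 2 * (C0 / h%:R) <= X `^ (1 / q).
  have y0 : 0 <= 2 * C0 / h%:R by rewrite !mulr_ge0 ?invr_ge0//; lra.
  rewrite mulrA -[leLHS](powR_rootK q0 y0) root_mono ?powR_ge0//.
  rewrite powR_div ?mulr_ge0//.
  rewrite /X ler_pdivrMr ?powR_gt0//.
  rewrite mulrAC ler_pdivlMr// [leLHS](_ : _ =
    (2 * C0) `^ q * (eps * (1 + eps)) * L); last by ring.
  have Lhq : L <= h%:R `^ q.
    by rewrite (le_trans Lh)// -[leLHS]powRr1 ?ler_powR// ltW.
  by apply: ler_pM => //; rewrite ?mulr_ge0 ?powR_ge0// ltW.
have second : 2 * (4 * K * (eta / J%:R / 2) `^ (1 / q)) <= X `^ (1 / q).
  rewrite !mulrA (_ : 2 * 4 = 8); last by ring.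
  rewrite -[X in X * _](powR_rootK q0) ?mulr_ge0 ?(ltW K0)//.
  rewrite -powRM ?powR_ge0 ?divr_ge0 ?(ltW eta0)//.
  rewrite root_mono ?mulr_ge0 ?powR_ge0 ?divr_ge0 ?invr_ge0 ?(ltW eta0)//.
  rewrite /X ler_pdivlMr// [leLHS](_ : _ =
    ((8 * K) `^ q * eta) * (1 + eps) * (eps * L) / (2 * J%:R)); last first.
    by field; lra.
  rewrite ler_pdivrMr ?mulr_gt0//.
  have c0 : 0 <= (8 * K) `^ q * eta * (1 + eps).
    by rewrite !mulr_ge0 ?powR_ge0//; lra.
  rewrite (le_trans (ler_wpM2l c0 EJ))//.
  rewrite [leLHS](_ : _ = (8 * K) `^ q * eta * (12 * a%:R * (1 + eps))
    * (2 * u * J%:R)); last by ring.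
  rewrite [leRHS](_ : _ = 1 * (2 * u * J%:R)); last by ring.
  by rewrite ler_wpM2r// !mulr_ge0// ltW.
by lra.
Qed.

(** The lower bound holds because k >= r.  For the upper one, k is at most
h^(3aJ) r n0 and h^(3aJ) <= t^(eps / 2); the remaining factor t^(eps / 2)
absorbs the constants, and rho >= 1 ensures t^eps <= t^(rho eps). *)
Lemma scale_range (R : realType) (eps rho c1 c2 t D : R) (a n0 h r J j : nat) :
  0 < eps -> 1 <= rho -> 0 < c1 -> 0 < c2 -> 0 < t ->
  (0 < n0)%N -> (0 < h)%N -> (0 < r)%N ->
  (t / c1) `^ rho <= r%:R -> r%:R <= 2 * (t / c1) `^ rho ->
  6 * a%:R * J%:R * ln h%:R <= eps * ln t ->
  2 * (ln 2 + rho * (ln c2 - ln c1) + ln n0%:R) <= eps * ln t ->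
  (j < J)%N ->
  let k := (h ^ a * ((h ^ (3 * a)) ^ j * (r * n0)))%N in
  c1 * k%:R `^ (1 / rho) <= D -> D <= c2 * k%:R `^ (1 / rho) ->
  t <= D /\ D <= t `^ (1 + eps).
Proof.
move=> eps0 rho1 c10 c20 t0 n00 h0 r0 rge rle hJ nt jJ k kD Dk.
have rho0 : 0 < rho by lra.
have k0 : (0 < k)%N by rewrite !muln_gt0 !expn_gt0 h0 r0.
have k0' : (0 : R) < k%:R by rewrite ltr0n.
split.
  apply: le_trans kD; rewrite mulrC -ler_pdivrMr//.
  rewrite -(powR_rootK rho0 (_ : 0 <= t / c1)) ?divr_ge0 ?(ltW t0) ?(ltW c10)//.
  rewrite ge0_ler_powR ?nnegrE ?divr_ge0 ?powR_ge0 ?(ltW rho0)//.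
  rewrite (le_trans rge)// ler_nat /k.
  rewrite (leq_trans _ (leq_pmull _ _)) ?expn_gt0 ?h0//.
  rewrite (leq_trans _ (leq_pmull _ _)) ?expn_gt0 ?expn_gt0 ?h0//.
  exact: leq_pmulr.
apply: le_trans Dk _.
rewrite -ler_ln ?posrE ?mulr_gt0 ?powR_gt0// ln_powR.
rewrite lnM ?posrE ?powR_gt0// ln_powR.
have lnh0 : 0 <= ln (h%:R : R) by rewrite ln_ge0 // ler1n.
have lnr : ln (r%:R : R) <= ln 2 + rho * (ln t - ln c1).
  rewrite -ln_div ?posrE// -ln_powR -lnM ?posrE ?powR_gt0 ?divr_gt0//.
  by rewrite ler_ln ?posrE ?mulr_gt0 ?powR_gt0 ?divr_gt0 ?ltr0n.
have lnk : ln (k%:R : R) = (a + 3 * a * j)%:R * ln h%:R + (ln r%:R + ln n0%:R).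
  rewrite /k mulnA -expnM -expnD natrM natrX.
  rewrite lnM ?posrE ?exprn_gt0 ?ltr0n//; last by rewrite muln_gt0 r0.
  by rewrite lnXn ?ltr0n// mulr_natl natrM lnM ?posrE ?ltr0n.
have aj : (a + 3 * a * j)%:R * ln (h%:R : R) <= 3 * a%:R * J%:R * ln h%:R.
  rewrite ler_wpM2r// -!natrM ler_nat.
  rewrite (leq_trans (_ : _ <= 3 * a * j.+1)%N) ?leq_mul2l ?jJ ?orbT//.
  by rewrite mulnS leq_add2r mulSn leq_addr.
have prho : eps * ln t <= rho * (eps * ln t).
  by rewrite ler_peMl// (le_trans _ hJ)// !mulr_ge0.
rewrite -(ler_pM2l rho0) mulrDr (mulrA rho) (mulrC rho (1 / rho)).
rewrite divfK ?gt_eqF// mul1r lnk.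
nra.
Qed.

Lemma lnln_eventually (R : realType) (B : R) : exists N : nat,
  forall t : R, N%:R <= t -> [/\ 0 < t, 0 < ln t & B < ln (ln t)].
Proof.
exists (Num.trunc (expR (expR B))).+1 => t Nt.
have tB : expR (expR B) < t by apply: lt_le_trans Nt; exact: truncnS_gt.
have t0 : 0 < t by apply: lt_trans tB; exact: expR_gt0.
have LB : expR B < ln t by rewrite -ltr_expR lnK.
have L0 : 0 < ln t by apply: lt_trans LB; exact: expR_gt0.
by split=> //; rewrite -ltr_expR lnK.
Qed.

(** With h = floor L + 1 and J the integer part of eps L / (6 a log h).  Both
L >= 1 + u and L >= u^2 / 2, where u = log L, come from the series of the
exponential; the latter gives J >= 1, and log h <= 2 u makes J of the right
order. *)
Lemma exists_scale_count (R : realType) (eps L : R) (a : nat) :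
  0 < eps -> (0 < a)%N -> 0 < L -> 1 <= ln L -> 24 * a%:R <= ln L * eps ->
  exists h J : nat, [/\ (0 < h)%N /\ (0 < J)%N, L <= h%:R,
    6 * a%:R * J%:R * ln h%:R <= eps * L
    & eps * L <= 24 * a%:R * ln L * J%:R].
Proof.
move=> eps0 a0 L0; set u := ln L => u1 au.
have u0 : 0 < u by exact: lt_le_trans u1.
have Lu : 1 + u <= L by rewrite -[L]lnK// expR_ge1Dx.
have Lu2 : u * u / 2 <= L.
  rewrite -[L]lnK//; have := expR_ge1Dxn 1 (ltW u0).
  by rewrite -/u (_ : (2`!)%:R = 2)// expr2; lra.
have uE : u = ln L by [].
clearbody u.
have aR : (0 : R) < a%:R by rewrite ltr0n.
have [h [h0 Lh lnh lnh0]] : exists h : nat,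
    [/\ (0 < h)%N, L <= h%:R, ln (h%:R : R) <= 2 * u & 0 < ln (h%:R : R)].
  exists (Num.trunc L).+1; have Lh := truncnS_gt L.
  have hL : (Num.trunc L).+1%:R <= L + 1.
    by rewrite -addn1 natrD lerD2r truncn_le ltW.
  have h1 : (1 : R) < (Num.trunc L).+1%:R by apply: le_lt_trans Lh; lra.
  split=> //; first exact: ltW; last by rewrite ln_gt0.
  rewrite mulr_natl uE -lnXn// ler_ln ?posrE ?exprn_gt0// expr2.
  apply: le_trans hL _; nra.
have den0 : 0 < 6 * a%:R * ln (h%:R : R) by rewrite !mulr_gt0.
pose y := eps * L / (6 * a%:R * ln h%:R).
have y1 : 1 <= y.
  rewrite ler_pdivlMr// mul1r.
  apply: (@le_trans _ _ (6 * a%:R * (2 * u))).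
    by rewrite ler_wpM2l// mulr_ge0.
  apply: (@le_trans _ _ (eps * (u * u / 2))); last by rewrite ler_pM2l.
  have := ler_wpM2l (ltW u0) au; lra.
have yE : y * (6 * a%:R * ln h%:R) = eps * L by rewrite divfK// gt_eqF.
clearbody y.
have Jy : (Num.trunc y)%:R <= y by rewrite truncn_le (le_trans ler01).
have J0 : (0 < Num.trunc y)%N by rewrite truncn_gt0.
have yJ : y <= 2 * (Num.trunc y)%:R.
  have := truncnS_gt y; rewrite -addn1 natrD.
  have : (1 : R) <= (Num.trunc y)%:R by rewrite ler1n.
  lra.
exists h, (Num.trunc y); move: (Num.trunc y) J0 Jy yJ => J J0 Jy yJ.
split=> //.
  by rewrite mulrAC mulrC -yE ler_wpM2r// ltW.
rewrite -yE; apply: le_trans (ler_wpM2r (ltW den0) yJ) _.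
rewrite [leRHS](_ : _ = 2 * J%:R * (6 * a%:R * (2 * u))); last by ring.
by rewrite !ler_wpM2l// mulr_ge0.
Qed.

Lemma le_of_sum_norm (R : realDomainType) (x1 x2 x3 x4 u : R) :
  1 + `|x1| + `|x2| + `|x3| + `|x4| < u ->
  [/\ 1 <= u, x1 <= u, x2 <= u, x3 <= u & x4 <= u].
Proof.
have := (normr_ge0 x1, normr_ge0 x2, normr_ge0 x3, normr_ge0 x4).
have := (ler_norm x1, ler_norm x2, ler_norm x3, ler_norm x4).
move: `|x1| `|x2| `|x3| `|x4| => y1 y2 y3 y4.
by move=> [[[b1 b2] b3] b4] [[[n1 n2] n3] n4] uU; split; lra.
Qed.

(** Every requirement on t amounts to log log t exceeding a constant, because
log t >= 1 + log log t. *)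
Lemma exists_parameters (R : realType) (q K eps eta C0 rho c1 c2 : R)
    (a n0 : nat) :
  1 <= q -> 0 < K -> 0 < eps -> 0 < eta -> 0 <= C0 -> 1 <= rho ->
  0 < c1 -> 0 < c2 -> (0 < a)%N -> (0 < n0)%N ->
  (8 * K) `^ q * eta * (12 * a%:R * (1 + eps)) <= 1 ->
  exists N : nat, forall t : R, N%:R <= t ->
  exists h r J : nat, [/\ (0 < h)%N, (0 < r)%N, (0 < J)%N &
    forall (j : nat) (D : R), (j < J)%N ->
    let k := (h ^ a * ((h ^ (3 * a)) ^ j * (r * n0)))%N in
    c1 * k%:R `^ (1 / rho) <= D -> D <= c2 * k%:R `^ (1 / rho) ->
    [/\ t <= D, D <= t `^ (1 + eps) &
      C0 / h%:R + 4 * K * (eta / J%:R / 2) `^ (1 / q)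
        <= (ln (ln D) / (eps * ln D)) `^ (1 / q)]].
Proof.
move=> q1 K0 eps0 eta0 C00 rho1 c10 c20 a0 n00 etaK.
(* The thresholds needed for the number of scales, for the error C0 / h and for
   the upper end of the range. *)
pose B1 := 24 * a%:R / eps.
pose B2 := (2 * C0) `^ q * (eps * (1 + eps)).
pose B3 := 2 * (ln 2 + rho * (ln c2 - ln c1) + ln (n0%:R : R)) / eps.
have [N N_large] := lnln_eventually (1 + `|B1| + `|B2| + `|B3| + `|ln c1|).
exists N => t /N_large[t0 L0 uU].
have [u1 uB1 uB2 uB3 uc1] : [/\ 1 <= ln (ln t), B1 <= ln (ln t),
    B2 <= ln (ln t), B3 <= ln (ln t) & ln c1 <= ln (ln t)].
  exact: le_of_sum_norm.
have [h [J [[h0 J0] Lh hJ EJ]]] : exists h J : nat, [/\ (0 < h)%N /\ (0 < J)%N,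
    ln t <= h%:R, 6 * a%:R * J%:R * ln h%:R <= eps * ln t
    & eps * ln t <= 24 * a%:R * ln (ln t) * J%:R].
  by apply: exists_scale_count => //; rewrite -ler_pdivrMr.
have uL : 1 + ln (ln t) <= ln t by rewrite -[leRHS]lnK// expR_ge1Dx.
have L1 : 1 <= ln t.
  by apply: le_trans uL; rewrite lerDl (le_trans ler01).
have uL' : ln (ln t) <= ln t by apply: le_trans uL; rewrite lerDr.
have tc1 : 1 <= t / c1.
  rewrite ler_pdivlMr// mul1r -ler_ln ?posrE//.
  exact: le_trans uL'.
have w1 : 1 <= (t / c1) `^ rho.
  by rewrite -(powRr0 (t / c1)) ler_powR// (le_trans ler01).
pose r := (Num.trunc ((t / c1) `^ rho)).+1.
have rge : (t / c1) `^ rho <= r%:R by apply/ltW; exact: truncnS_gt.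
have rle : r%:R <= 2 * (t / c1) `^ rho.
  by rewrite /r -addn1 natrD mulr_natl mulr2n lerD// truncn_le (le_trans ler01).
exists h, r, J; split => // j D jJ k kD Dk.
have nt : 2 * (ln 2 + rho * (ln c2 - ln c1) + ln (n0%:R : R)) <= eps * ln t.
  by rewrite [leRHS]mulrC -ler_pdivrMr// (le_trans uB3).
have [tD Dt] := scale_range eps0 rho1 c10 c20 t0 n00 h0
  (isT : (0 < r)%N) rge rle hJ nt jJ kD Dk.
have D0 : 0 < D by exact: lt_le_trans tD.
have LD : ln t <= ln D by rewrite ler_ln ?posrE.
have lnD0 : 0 < ln D by exact: lt_le_trans LD.
split => //; apply: (@rate_bound _ _ _ _ _ _ (ln (ln t)) (ln t) _ a) => //.
- exact: lt_le_trans u1.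
- by rewrite -ln_powR ler_ln ?posrE ?powR_gt0.
- by rewrite ler_ln ?posrE.
Qed.

(** * Bounded functions and the seminorm of an invariant mean *)

Section BoundedFunctions.
Variables (R : realType) (T : Type) (X : normedModType R).

Definition bounded_map : {pred T -> X} :=
  fun phi => `[< exists c : R, forall x, `|phi x| <= c >].

Lemma bounded_mapP phi :
  reflect (exists c : R, forall x, `|phi x| <= c) (phi \in bounded_map).
Proof. exact: asboolP. Qed.

Lemma bounded_map_submod_closed : submod_closed bounded_map.
Proof.
split; first by apply/bounded_mapP; exists 0 => x; rewrite normr0.
move=> a phi psi /bounded_mapP[b phi_b] /bounded_mapP[c psi_c].
apply/bounded_mapP; exists (`|a| * b + c) => x.
by rewrite (le_trans (ler_normD _ _))// lerD// normrZ ler_wpM2l.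
Qed.

HB.instance Definition _ :=
  GRing.isSubmodClosed.Build R (T -> X) bounded_map bounded_map_submod_closed.

Record bmap := BMap { bmap_val :> T -> X; _ : bmap_val \in bounded_map }.

HB.instance Definition _ := [isSub for bmap_val].
HB.instance Definition _ := [Choice of bmap by <:].
HB.instance Definition _ := [SubChoice_isSubLmodule of bmap by <:].

Lemma bmap_bounded (phi : bmap) : exists c : R, forall x, `|phi x| <= c.
Proof. by case: phi => phi phi_b; exact/bounded_mapP. Qed.

End BoundedFunctions.

Section Translation.
Variables (R : realType) (G : groupType) (X : normedModType R).

Lemma translate_bounded g (phi : bmap G X) :
  (fun x => phi (x * g)%g) \in @bounded_map R G X.
Proof.
by apply/bounded_mapP; have [c phi_c] := bmap_bounded phi; exists c.
Qed.

Definition translate g (phi : bmap G X) : bmap G X :=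
  BMap (translate_bounded g phi).

Lemma translate_linear g : linear (translate g).
Proof. by move=> a phi psi; apply/val_inj. Qed.

HB.instance Definition _ g :=
  GRing.isLinear.Build R (bmap G X) (bmap G X) _ (translate g)
    (@translate_linear g).

End Translation.

Lemma bounded_funP (R : realType) (T : Type) (u : T -> R) :
  bounded_fun u <-> exists c : R, forall x, `|u x| <= c.
Proof.
split=> [[c [_ uc]]|[c uc]].
  by exists (c + 1) => x; apply: (uc (c + 1)); rewrite ?ltrDl.
exists c; split; first exact: num_real.
by move=> M cM x _ /=; exact: le_trans (uc x) (ltW cM).
Qed.

(** The inversion turns the left invariance of the mean into the invariance of
[mean_norm] under the right translations, which are the ones that act on
increments. *)
Definition qpower (R : realType) (G : groupType) (X : normedModType R) (q : R)
    (phi : bmap G X) : G -> R :=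
  fun x => `|phi (x^-1)%g| `^ q.

HB.lock Definition mean_norm (R : realType) (G : groupType)
    (X : normedModType R) (q : R) (m : (G -> R) -> R) (phi : bmap G X) : R :=
  m (qpower q phi) `^ (1 / q).

Section MeanSeminorm.
Variables (R : realType) (G : groupType) (X : normedModType R) (q : R).
Hypothesis q_ge1 : 1 <= q.
Variable m : (G -> R) -> R.
Hypothesis m_lin : forall (a : R) (u v : G -> R),
  bounded_fun u -> bounded_fun v ->
  m (fun x => a * u x + v x) = a * m u + m v.
Hypothesis m_ge0 : forall u : G -> R,
  bounded_fun u -> (forall x, 0 <= u x) -> 0 <= m u.
Hypothesis m_one : m (fun=> 1) = 1.
Hypothesis m_inv : forall (g : G) (u : G -> R), bounded_fun u ->
  m (fun x => u (g * x)%g) = m u.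

Lemma bounded_comb a b (u w : G -> R) : bounded_fun u -> bounded_fun w ->
  bounded_fun (fun x => a * u x + b * w x).
Proof.
move=> /bounded_funP[c uc] /bounded_funP[d wd].
apply/bounded_funP; exists (`|a| * c + `|b| * d) => x.
by rewrite (le_trans (ler_normD _ _))// lerD// normrM ler_wpM2l.
Qed.

Lemma bounded_cst_fun (c : R) : bounded_fun (fun _ : G => c).
Proof. by apply/bounded_funP; exists `|c|. Qed.

Lemma mean0 : m (fun=> 0) = 0.
Proof.
rewrite (_ : (fun=> 0) = fun _ : G => -1 * 1 + 1 :> R).
  by rewrite m_lin ?m_one ?mulN1r ?addNr//; exact: bounded_cst_fun.
by apply/funext => x; rewrite mulN1r addNr.
Qed.

Lemma mean_scale a (u : G -> R) : bounded_fun u ->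
  m (fun x => a * u x) = a * m u.
Proof.
move=> ub; rewrite -[RHS]addr0 -mean0 -m_lin//; last exact: bounded_cst_fun.
by congr m; apply/funext => x; rewrite addr0.
Qed.

Lemma mean_comb a b (u w : G -> R) : bounded_fun u -> bounded_fun w ->
  m (fun x => a * u x + b * w x) = a * m u + b * m w.
Proof.
move=> ub wb; rewrite m_lin ?mean_scale//.
have := bounded_comb b 0 wb wb.
rewrite (_ : (fun x => _ + _) = fun x => b * w x)//.
by apply/funext => x; rewrite mul0r addr0.
Qed.

Lemma mean_le (u w : G -> R) : bounded_fun u -> bounded_fun w ->
  (forall x, u x <= w x) -> m u <= m w.
Proof.
move=> ub wb uw; rewrite -subr_ge0 -[m w]mul1r -mulN1r -mean_comb//.
apply: m_ge0 => [|x]; first exact: bounded_comb.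
by rewrite mul1r mulN1r subr_ge0.
Qed.

Lemma mean_cst c : m (fun=> c) = c.
Proof.
rewrite -[RHS]mulr1 -m_one -mean_scale; last exact: bounded_cst_fun.
by congr m; apply/funext => x; rewrite mulr1.
Qed.

Local Notation N := (@mean_norm R G X q m).
Implicit Types phi psi chi xi : bmap G X.

Let q_gt0 : 0 < q. Proof. exact: lt_le_trans ltr01 q_ge1. Qed.

Lemma qpower_bounded phi : bounded_fun (qpower q phi).
Proof.
have [c phi_c] := bmap_bounded phi.
apply/bounded_funP; exists (c `^ q) => x.
rewrite ger0_norm ?powR_ge0// ge0_ler_powR ?nnegrE ?(ltW q_gt0)//.
exact: le_trans (phi_c x).
Qed.

Lemma mean_qpower_ge0 phi : 0 <= m (qpower q phi).
Proof. by apply: m_ge0 => [|x]; [exact: qpower_bounded|exact: powR_ge0]. Qed.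

Lemma mean_normX phi : N phi `^ q = m (qpower q phi).
Proof. by rewrite mean_norm.unlock powR_rootVK// mean_qpower_ge0. Qed.

Lemma mean_norm_le c (phi : bmap G X) : (forall x, `|phi x| <= c) -> N phi <= c.
Proof.
move=> phi_c; have c0 : 0 <= c by exact: le_trans (normr_ge0 _) (phi_c 1%g).
rewrite mean_norm.unlock -[leRHS](powR_rootK q_gt0)//.
rewrite ge0_ler_powR ?nnegrE ?mulr_ge0 ?invr_ge0 ?powR_ge0 ?mean_qpower_ge0
  ?(ltW q_gt0)//.
rewrite -[leRHS]mean_cst; apply: mean_le => [||x].
- exact: qpower_bounded.
- exact: bounded_cst_fun.
- by rewrite ge0_ler_powR ?nnegrE ?(ltW q_gt0).
Qed.

Lemma mean_norm_ge c (phi : bmap G X) : 0 <= c ->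
  (forall x, c <= `|phi x|) -> c <= N phi.
Proof.
move=> c0 phi_c; rewrite mean_norm.unlock -[leLHS](powR_rootK q_gt0)//.
rewrite ge0_ler_powR ?nnegrE ?mulr_ge0 ?invr_ge0 ?powR_ge0 ?mean_qpower_ge0
  ?(ltW q_gt0)//.
rewrite -[leLHS]mean_cst; apply: mean_le => [||x].
- exact: bounded_cst_fun.
- exact: qpower_bounded.
- by rewrite ge0_ler_powR ?nnegrE ?(ltW q_gt0).
Qed.

Lemma mean_norm_translate g phi : N (translate g phi) = N phi.
Proof.
rewrite mean_norm.unlock -(m_inv (g^-1)%g (qpower_bounded phi)); congr (_ `^ _).
by congr m; apply/funext => x; rewrite /qpower/= invgM invgK.
Qed.

(** Minkowski's inequality, by taking means in [powR_add_le].  The strict bounds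
keep a and b positive when a seminorm vanishes. *)
Lemma mean_normD_lt phi psi a b : N phi < a -> N psi < b ->
  N (phi + psi) <= a + b.
Proof.
move=> phi_a psi_b.
have N0 chi : 0 <= N chi by rewrite mean_norm.unlock powR_ge0.
have a0 : 0 < a by exact: le_lt_trans phi_a.
have b0 : 0 < b by exact: le_lt_trans psi_b.
have ab0 : 0 < a + b by rewrite addr_gt0.
rewrite [in leLHS]mean_norm.unlock -[leRHS](powR_rootK q_gt0) ?(ltW ab0)//.
rewrite ge0_ler_powR ?nnegrE ?mulr_ge0 ?invr_ge0 ?powR_ge0 ?mean_qpower_ge0
  ?(ltW q_gt0)//.
pose A := (a + b) `^ q * (a / (a + b) / a `^ q).
pose B := (a + b) `^ q * (b / (a + b) / b `^ q).
have A0 : 0 <= A.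
  by rewrite /A !mulr_ge0 ?invr_ge0 ?powR_ge0 ?(ltW a0) ?(ltW ab0).
have B0 : 0 <= B.
  by rewrite /B !mulr_ge0 ?invr_ge0 ?powR_ge0 ?(ltW b0) ?(ltW ab0).
have split_AB y z : (a + b) `^ q * (a / (a + b) * (y / a `^ q)
    + b / (a + b) * (z / b `^ q)) = A * y + B * z by rewrite /A /B; ring.
apply: (@le_trans _ _ (m (fun x => A * qpower q phi x + B * qpower q psi x))).
  apply: mean_le => [||x]; first exact: qpower_bounded.
    by apply: bounded_comb; exact: qpower_bounded.
  rewrite /qpower -split_AB.
  apply: le_trans (powR_add_le q_ge1 a0 b0 (normr_ge0 _) (normr_ge0 _)).
  rewrite ge0_ler_powR ?nnegrE ?addr_ge0 ?(ltW q_gt0)//.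
  exact: ler_normD.
rewrite mean_comb; [|exact: qpower_bounded|exact: qpower_bounded].
rewrite -!mean_normX -split_AB.
have le1 chi c : 0 < c -> N chi <= c -> N chi `^ q / c `^ q <= 1.
  move=> c0 chic; rewrite ler_pdivrMr ?powR_gt0// mul1r.
  by rewrite ge0_ler_powR ?nnegrE ?(ltW q_gt0) ?(ltW c0).
have ha : N phi `^ q / a `^ q <= 1 by apply: le1 => //; exact: ltW.
have hb : N psi `^ q / b `^ q <= 1 by apply: le1 => //; exact: ltW.
rewrite ler_piMr ?powR_ge0//.
have ab1 : a / (a + b) * 1 + b / (a + b) * 1 = 1.
  by rewrite !mulr1 -mulrDl divff// gt_eqF.
rewrite -[leRHS]ab1.
by rewrite lerD// ler_wpM2l// divr_ge0 ?(ltW a0) ?(ltW b0) ?(ltW ab0).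
Qed.

Lemma mean_normD phi psi : N (phi + psi) <= N phi + N psi.
Proof.
apply/ler_addgt0Pr => e e0; rewrite {1}(splitr e) addrACA.
by apply: mean_normD_lt; rewrite ltrDl divr_gt0.
Qed.

Lemma mean_norm_seminorm : is_seminorm N.
Proof.
split=> [|a phi]; first exact: mean_normD.
rewrite mean_norm.unlock.
rewrite (_ : qpower q (a *: phi) = fun x => `|a| `^ q * qpower q phi x).
  rewrite mean_scale ?powRM ?powR_ge0 ?mean_qpower_ge0 ?powR_rootK//.
  exact: qpower_bounded.
by apply/funext => x; rewrite /qpower/= normrZ powRM.
Qed.

(** Seminorms enter the q-convexity inequality only through their q-th powers,
which are means, so the inequality follows from its pointwise version. *)
Lemma mean_norm_parallelogram kappa (phi psi chi xi : bmap G X) :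
  (forall x, `|phi x| `^ q + kappa * `|psi x| `^ q
    <= (`|chi x| `^ q + `|xi x| `^ q) / 2) ->
  N phi `^ q + kappa * N psi `^ q
    <= (N chi `^ q + N xi `^ q) / 2.
Proof.
have qb := qpower_bounded; move=> pointwise; rewrite !mean_normX.
have -> : (m (qpower q chi) + m (qpower q xi)) / 2 =
    m (fun x => 2^-1 * qpower q chi x + 2^-1 * qpower q xi x).
  by rewrite mean_comb; [rewrite -mulrDr mulrC|exact: qb|exact: qb].
rewrite -[m (qpower q phi)]mul1r -mean_comb; [|exact: qb|exact: qb].
apply: mean_le => [||x].
- by apply: bounded_comb; exact: qb.
- by apply: bounded_comb; exact: qb.
- by rewrite mul1r -mulrDr [leRHS]mulrC; exact: pointwise.
Qed.

Lemma mean_norm_convex K :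
  (forall x y : X, `|x| `^ q + (K `^ q)^-1 * `|y| `^ q
    <= (`|x + y| `^ q + `|x - y| `^ q) / 2) ->
  q_convex q K N.
Proof. by move=> X_convex phi psi; apply: mean_norm_parallelogram => x. Qed.

End MeanSeminorm.

(** * The word distance and the cocycle of increments *)

Section WordDistance.
Variables (R : realType) (G : groupType) (S : set G).

Lemma word_dist_translate (x g : G) :
  word_dist R S (x * g)%g x = word_dist R S g 1%g.
Proof.
rewrite /word_dist; congr inf; apply/seteqP; split => _ [n [w [sw wS gw]] <-];
  exists n => //; exists w; split => //.
  by rewrite mul1g; apply: mulgI gw.
by rewrite gw mul1g.
Qed.

Lemma word_dist_le (w : seq G) (g : G) : (forall a, a \in w -> S a) ->
  g = (\prod_(a <- w) a)%g -> word_dist R S g 1%g <= (size w)%:R.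
Proof.
move=> wS gw; apply: ge_inf; first by exists 0 => _ [n _ <-].
by exists (size w) => //; exists w; rewrite mul1g.
Qed.

Lemma word_dist_attained (g : G) :
  (exists w : seq G, (forall a, a \in w -> S a) /\ g = (\prod_(a <- w) a)%g) ->
  exists w : seq G, [/\ (size w)%:R = word_dist R S g 1%g,
    forall a, a \in w -> S a & g = (\prod_(a <- w) a)%g].
Proof.
move=> [w0 [w0S gw0]].
pose P n := `[< exists w : seq G,
  [/\ size w = n, forall a, a \in w -> S a & g = (\prod_(a <- w) a)%g] >].
have exP : exists n, P n by exists (size w0); apply/asboolP; exists w0.
case: (ex_minnP exP) => n /asboolP[w [sw wS gw]] n_min.
exists w; split=> //; apply/eqP; rewrite eq_le word_dist_le// andbT.
apply: lb_le_inf.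
  by exists (size w)%:R, (size w) => //; exists w; rewrite mul1g.
move=> _ [i [w' [sw' w'S gw']] <-]; rewrite sw ler_nat n_min//.
by apply/asboolP; exists w'; rewrite -(mul1g (\prod_(a <- w') a)%g).
Qed.

(** The infimum of the empty set is 0, so a positive distance is witnessed by a
word. *)
Lemma word_of_dist_gt0 (g : G) : 0 < word_dist R S g 1%g ->
  exists w : seq G, (forall a, a \in w -> S a) /\ g = (\prod_(a <- w) a)%g.
Proof.
rewrite /word_dist; set E := (X in inf X).
have [->|/set0P[_ [n [w [_ wS gw]] _]] _] := eqVneq E set0.
  by rewrite inf0 ltxx.
by exists w; rewrite gw mul1g.
Qed.

End WordDistance.

Section TranslationCocycle.
Variables (R : realType) (G : groupType) (S : set G) (X : normedModType R).
Variable f : G -> X.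
Hypothesis f_lip : lipschitz1 (word_dist R S) f.

Lemma increment_bound (g x : G) : `|f (x * g)%g - f x| <= word_dist R S g 1%g.
Proof. by rewrite (le_trans (f_lip _ _))// word_dist_translate. Qed.

Lemma increment_bounded g :
  (fun x => f (x * g)%g - f x) \in @bounded_map R G X.
Proof.
apply/bounded_mapP; exists (word_dist R S g 1%g) => x.
exact: increment_bound.
Qed.

Definition increment g : bmap G X := BMap (increment_bounded g).

Lemma increment_cocycle g h :
  increment (g * h)%g = increment g + translate g (increment h).
Proof.
apply/val_inj/funext => x /=.
rewrite [RHS](_ : _ = (f (x * g)%g - f x) + (f (x * g * h)%g - f (x * g)%g))//.
by rewrite mulgA [RHS]addrC subrKA.
Qed.

End TranslationCocycle.

(** * Lower bounds on the convexity constant *)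

Lemma convexity_const_ge0 (R : realType) (q : R) (X : normedModType R) :
  (0 <= convexity_const q X)%E.
Proof. by apply: le_ereal_inf_tmp => _ [K [K0 _] <-]; rewrite lee_fin ltW. Qed.

Lemma convexity_const_ge1 (R : realType) (q : R) (X : normedModType R) (y : X) :
  0 < q -> y != 0 -> (1 <= convexity_const q X)%E.
Proof.
move=> q0 y0; apply: le_ereal_inf_tmp => _ [K [K0 K_adm] <-].
have ny : 0 < `|y| `^ q by rewrite powR_gt0// normr_gt0.
have := K_adm 0 y; rewrite add0r sub0r normrN normr0 powR0 ?gt_eqF// add0r.
rewrite mulrDl -splitr -[leRHS]mul1r ler_pM2r// => Kq.
rewrite lee_fin leNgt; apply/negP => K1.
have : K `^ q < 1 `^ q by rewrite gt0_ltr_powR ?nnegrE ?(ltW K0).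
by rewrite powR1 ltNge -invf_le1 ?Kq// powR_gt0.
Qed.

(** * The compression bound *)

Theorem theorem15 (R : realType) (G : groupType) (S : set G)
    (G_amenable : amenable R G)
    (S_fin : finite_set S) (S_sym : symmetric_set S) (S_gen : generating_set S)
    (v : G) (v_central : forall g : G, commute v g)
    (rho : R) (rho_gt1 : 1 < rho)
    (c1 c2 : R) (c1_gt0 : 0 < c1) (c1_le_c2 : c1 <= c2)
    (v_dist : forall k : nat, (1 <= k)%N ->
      c1 * k%:R `^ (1 / rho) <= word_dist R S (v ^+ k)%g 1%g /\
      word_dist R S (v ^+ k)%g 1%g <= c2 * k%:R `^ (1 / rho)) :
  exists C : R,
    forall (q : R), 2 <= q ->
    forall (X : completeNormedModType R), uniformly_convex q X ->
    forall (f : G -> X), lipschitz1 (word_dist R S) f ->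
    forall (omega : R -> R), is_compression_rate (word_dist R S) f omega ->
    forall eps : R, 0 < eps ->
    exists N : nat, forall t : R, N%:R <= t ->
    exists n : nat,
      [/\ t <= n%:R, n%:R <= t `^ (1 + eps)
        & omega n%:R / n%:R
            <= C * fine (convexity_const q X)
                 * (ln (ln n%:R) / (eps * ln n%:R)) `^ (1 / q)].
Proof.
have c2_gt0 : 0 < c2 by lra.
have rho_gt0 : 0 < rho by lra.
have [m [m_lin m_ge0 m_one m_inv]] := G_amenable.
pose d k := Num.trunc (word_dist R S (v ^+ k)%g 1%g).
(* Positive lengths are realised by words; the empty word serves for k = 0. *)
have v_shortest k : exists w : seq G,
    [/\ (size w)%:R = word_dist R S (v ^+ k)%g 1%g, forall a, a \in w -> S a
      & (v ^+ k = \prod_(a <- w) a)%g].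
  apply: word_dist_attained; case: k => [|k].
    by exists [::]; split=> //; rewrite big_nil.
  apply: (@word_of_dist_gt0 R); apply: lt_le_trans (v_dist k.+1 isT).1.
  by rewrite mulr_gt0 ?powR_gt0.
have dE k : (d k)%:R = word_dist R S (v ^+ k)%g 1%g :> R.
  by have [w [sw _ _]] := v_shortest k; rewrite /d -sw natrK.
have v_word k : exists w : seq G,
    [/\ size w = d k, forall a, a \in w -> S a & (v ^+ k = \prod_(a <- w) a)%g].
  have [w [sw wS vw]] := v_shortest k; exists w; split=> //.
  by rewrite /d -sw natrK.
have d_ge k : (0 < k)%N -> c1 * k%:R `^ (1 / rho) <= (d k)%:R.
  by move=> k0; rewrite dE; exact: (v_dist k k0).1.
have d_le k : (0 < k)%N -> (d k)%:R <= c2 * k%:R `^ (1 / rho).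
  by move=> k0; rewrite dE; exact: (v_dist k k0).2.
pose a := (Num.trunc (rho + rho / (rho - 1))).+1.
(* This a makes both a / rho and a (1 - 1 / rho) at least 1. *)
have a_gt : rho + rho / (rho - 1) < a%:R by exact: truncnS_gt.
have a_rho : 1 <= a%:R / rho.
  rewrite ler_pdivlMr// mul1r.
  have : 0 <= rho / (rho - 1) by rewrite divr_ge0; lra.
  lra.
have a_conj : 1 <= a%:R * (1 - 1 / rho).
  have -> : 1 - 1 / rho = (rho - 1) / rho by field; lra.
  rewrite mulrA ler_pdivlMr// mul1r -ler_pdivrMr; lra.
exists 1 => q q2 X X_convex f f_lip omega [[omega_ge0 _ omega_le] _] eps eps0.
have q_ge1 : 1 <= q by lra.
have q_gt0 : 0 < q by lra.
have [K [K_gt0 K_adm]] : exists K : R, 0 < K /\ forall x y : X,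
    `|x| `^ q + (K `^ q)^-1 * `|y| `^ q <= (`|x + y| `^ q + `|x - y| `^ q) / 2.
  by have [_ [K KP <-] _] := ereal_inf_lt X_convex; exists K.
pose p := mean_norm q m (X := X).
have p_seminorm : is_seminorm p by exact: mean_norm_seminorm.
have p_convex : q_convex q K p by exact: mean_norm_convex.
pose pi (g : G) : {linear bmap G X -> bmap G X} := translate g.
have pi1 x : pi 1%g x = x by apply/val_inj/funext => y /=; rewrite mulg1.
have piM g h x : pi (g * h)%g x = pi g (pi h x).
  by apply/val_inj/funext => y /=; rewrite mulgA.
have pi_isom g x : p (pi g x) = p x by exact: mean_norm_translate.
have F_cocycle := increment_cocycle f_lip.
have F_gen s : S s -> p (increment f_lip s) <= 1.
  move=> Ss; apply: mean_norm_le => // x.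
  apply: le_trans (increment_bound f_lip _ _) _.
  apply: (@word_dist_le R G S [:: s]); last by rewrite big_seq1.
  by move=> b; rewrite inE => /eqP ->.
(* The largest value that the choice of scales allows; K is any admissible
   constant, since the final bound no longer depends on it. *)
pose eta := ((8 * K) `^ q * (12 * a%:R * (1 + eps)))^-1.
have eps1 : 0 < 1 + eps by lra.
have eta_den : 0 < (8 * K) `^ q * (12 * a%:R * (1 + eps)).
  by rewrite !mulr_gt0 ?powR_gt0 ?mulr_gt0.
have eta0 : 0 < eta by rewrite invr_gt0.
have [n0 n0_gt0 small] := cocycle_small_somewhere p_seminorm pi1 piM pi_isom
  F_cocycle v_central F_gen v_word q_gt0 K_gt0 p_convex S_fin c1_gt0 c2_gt0
  rho_gt0 d_ge d_le a_rho a_conj eta0.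
have C0_ge0 : 0 <= 3 * (c2 / c1) + 2 
  by rewrite addr_ge0// mulr_ge0// divr_ge0// ltW.
have eta_small : (8 * K) `^ q * eta * (12 * a%:R * (1 + eps)) <= 1.
  by rewrite mulrAC mulfV ?gt_eqF.
have [N params] := exists_parameters q_ge1 K_gt0 eps0 eta0 C0_ge0 (ltW rho_gt1)
  c1_gt0 c2_gt0 (isT : (0 < a)%N) n0_gt0 eta_small.
exists N => t /params[h [r [J [h0 r0 J0 range]]]].
have [j jJ Fk] := small h r J h0 r0 J0.
have k_gt0 : (0 < h ^ a * ((h ^ (3 * a)) ^ j * (r * n0)))%N.
  by rewrite !muln_gt0 !expn_gt0 h0 r0.
have [tk kt rate] := range j _ jJ (d_ge _ k_gt0) (d_le _ k_gt0).
move: Fk tk kt rate => /=; set k := (h ^ a * _)%N in k_gt0 * => Fk tk kt rate.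
exists (d k); split=> //; rewrite mul1r.
have dk_gt0 : (0 : R) < (d k)%:R.
  by apply: lt_le_trans (d_ge k k_gt0); rewrite mulr_gt0 ?powR_gt0 ?ltr0n.
have omega_incr x : omega (d k)%:R <= `|f (x * v ^+ k)%g - f x|.
  have dx : word_dist R S (x * v ^+ k)%g x = (d k)%:R.
    by rewrite word_dist_translate dE.
  by rewrite -dx; apply: omega_le; rewrite dx.
have Kfin : convexity_const q X \is a fin_num.
  by rewrite ge0_fin_numE// convexity_const_ge0.
have [[y y0]|X0] := pselect (exists y : X, y != 0).
  have K1 : 1 <= fine (convexity_const q X).
    by rewrite -lee_fin fineK// (convexity_const_ge1 q_gt0 y0).
  rewrite ler_pdivrMr//.
  have omega_p : omega (d k)%:R <= p (increment f_lip (v ^+ k)%g).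
    by apply: mean_norm_ge => //; exact: omega_ge0.
  apply: le_trans omega_p _; apply: le_trans Fk _.
  rewrite mulrC ler_pM2r//; apply: le_trans rate _.
  by rewrite ler_peMl ?powR_ge0.
(* When X = 0 the compression rate vanishes at every attained distance. *)
have f0 x : f x = 0.
  by apply/eqP; apply: contrapT => /negP fx; apply: X0; exists (f x).
have := omega_incr 1%g; rewrite !f0 subrr normr0 => omega0.
apply: (@le_trans _ _ 0); first by rewrite pmulr_lle0 ?invr_gt0.
by rewrite mulr_ge0 ?powR_ge0// fine_ge0// convexity_const_ge0.
Qed.
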